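(* Let $n\ge 0$ be an integer, let $\sigma$ be a real number, let $\beta\ge 0$ be a real number with $\beta\neq 1$, and let $0\le\gamma<1$. Then $$K_{n}^{\sigma}(\beta,\gamma)\subset K_n^{\sigma+1}(\beta,\gamma).$$
   Context: Let $E=\{z\in\mathbb{C}:|z|<1\}$ and let $A$ be the class of functions $f(z)=z+\sum_{k=2}^\infty a_kz^k$ analytic in $E$. For an integer $n\ge 0$ and real $\sigma$, define for $f\in A$ $$L_n^\sigma f(z)=z+\sum_{k=2}^\infty k^n\left(\frac{2}{k+1}\right)^{\sigma}a_kz^k .$$ Equivalently $L_n^\sigma f=D^n(I^\sigma f)=I^\sigma(D^nf)$, where $D^0f=f$, $D^nf(z)=z\,[D^{n-1}f(z)]'$ is the Salagean derivative, and $I^\sigma f(z)=z+\sum_{k\ge 2}\left(\frac{2}{k+1}\right)^\sigma a_kz^k$ is the Jung-Kim-Srivastava operator (for $\sigma>0$ it equals $\frac{2^\sigma}{z\Gamma(\sigma)}\int_0^z\left(\log\frac zt\right)^{\sigma-1}f(t)\,dt$). For a nonnegative real number $\delta\neq 1$, the notation ''$X\sim\delta$'' means $X>\delta$ if $0\le\delta<1$, and $X<\delta$ if $\delta>1$. The class $B_n^\sigma(\gamma)$ (for real $\gamma\ge 0$, $\gamma\ne 1$) consists of all $f\in A$ such that $\operatorname{Re}\dfrac{L_{n+1}^\sigma f(z)}{L_n^\sigma f(z)}\sim\gamma$ for all $z\in E$. The class $K_n^\sigma(\beta,\gamma)$ (for real $\beta\ge 0$, $\beta\neq 1$, and $0\le\gamma<1$)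 consists of all $f\in A$ for which there exists $g\in B_n^\sigma(\gamma)$ with $\operatorname{Re}\dfrac{L_{n+1}^\sigma f(z)}{L_n^\sigma g(z)}\sim\beta$ for all $z\in E$. In these conditions the quotients are understood as meromorphic functions on $E$ with removable singularities removed (so their value at $z=0$ is $1$), and the inequality is required at every point of $E$; in particular the quotient must have no poles in $E$. *)

(* Defs.v *)
From Stdlib Require Export Reals ClassicalEpsilon.
From Coquelicot Require Export Coquelicot.
Open Scope R_scope.

Definition in_E (z : C) : Prop := Cmod z < 1.

(* [f(z) = z + sum_(k >= 2) a_k z^k] at every point of the unit disk. *)
Definition normalized_expansion (f : C -> C) (a : nat -> C) : Prop :=
  a 0%nat = RtoC 0 /\ a 1%nat = RtoC 1 /\
  forall z : C, in_E z ->
    is_pseries (K := C_AbsRing) (V := C_NormedModule) a z (f z).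

(* Functions are total on [C]; only their values on the unit disk matter. *)
Definition class_A (f : C -> C) : Prop := exists a, normalized_expansion f a.

(* For [f] in [class_A] the sequence is unique, by uniqueness of power series
   expansions; for other [f] it is unspecified. *)
Definition coef (f : C -> C) : nat -> C :=
  epsilon (inhabits (fun _ : nat => RtoC 0)) (normalized_expansion f).

(* The sum of a convergent complex power series, unspecified otherwise. *)
Definition CPSeries (a : nat -> C) (z : C) : C :=
  iota (fun l : C_CompleteNormedModule =>
    is_pseries (K := C_AbsRing) (V := C_NormedModule) a z l).

(* The multiplier is 1 at [k = 1] and irrelevant at [k = 0], where
   [coef f 0 = 0]; the series converges on the disk because the multiplier
   has polynomial growth. *)
Definition L (n : nat) (sigma : R) (f : C -> C) (z : C) : C :=
  CPSeries (fun k : nat =>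
    Cmult (RtoC (INR k ^ n * Rpower (2 / (INR k + 1)) sigma)) (coef f k)) z.

(* [X ~ delta]; false for the excluded value [delta = 1]. *)
Definition sim (X delta : R) : Prop :=
  (0 <= delta < 1 /\ X > delta) \/ (delta > 1 /\ X < delta).

(* [w] is the value at [z] of the meromorphic function [F / G] after removal of
   removable singularities: the limit along the punctured neighbourhoods
   of [z], which exists in [C] exactly when [z] is not a pole (for analytic
   [F], [G] with [G] not identically zero; zeros of [G] are then isolated). *)
Definition quotient_value (F G : C -> C) (z w : C) : Prop :=
  filterlim (fun u : C => Cdiv (F u) (G u)) (locally' z) (locally w).

Definition Re_quotient_sim (F G : C -> C) (delta : R) : Prop :=
  forall z : C, in_E z -> exists w : C, quotient_value F G z w /\ sim (Re w) delta.

Definition class_B (n : nat) (sigma gamma : R) (f : C -> C) : Prop :=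
  class_A f /\ Re_quotient_sim (L (S n) sigma f) (L n sigma f) gamma.

Definition class_K (n : nat) (sigma beta gamma : R) (f : C -> C) : Prop :=
  class_A f /\
  exists g : C -> C, class_B n sigma gamma g /\
    Re_quotient_sim (L (S n) sigma f) (L n sigma g) beta.

(* Main.v *)
(* Put F = L_n^(sigma+1) f, G = L_n^(sigma+1) g and write D u = z u'.  The multipliers give
   2 L_n^sigma u = D (L_n^(sigma+1) u) + L_n^(sigma+1) u, so with p = D G / G and q = D F / G
   the hypothesis reads Re (q + D q / (p + 1)) ~ beta.  If Re q - beta first reached the wrong
   sign at z0, moving from z0 in the direction - z0 / (p(z0) + 1), which points into the disk
   |z| < |z0| because Re (p + 1) > 0, would give Re (D q / (p + 1)) <= 0 (>= 0 if beta > 1)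
   at z0, a contradiction.  The case F = G gives Re p > gamma; there G cannot vanish first,
   since |G| increases along radii as long as Re p > 0. *)
Require Import Defs.
From Stdlib Require Import Lra Lia.

(** Substituting D F = q G gives D (D F) = (D q + q p) G, which is why the hypothesis takes the form
    q + D q / (p + 1). The direction is chosen so that the first-order change of q along it is
    exactly - D q / (p + 1). A single difference quotient along a segment therefore settles the
    sign, without a maximum principle or Jack's lemma, and analyticity enters the boundary argument
    only through a second-order Taylor estimate for power series.

    Two obstacles shape the rest. The quotients are 0 / 0 at the origin, so D F and G are divided by
    z, and q becomes a quotient of functions with value 1 at 0. The hypotheses speak of limits of
    quotients, while division by zero yields 0, so no denominator can be assumed free of zeros: for
    exponent sigma the zeros are excluded by a finite limit with positive real part, for sigma + 1
    by a test function that involves no division. The witness g is the same for both exponents. *)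

(** * Coefficient growth and convergence in the disk *)

(** Says that the radius of convergence is at least 1, in a form that is easily seen to survive
    index shifts and factors of polynomial growth. *)
Definition subgeometric (a : nat -> C) : Prop :=
  forall r, 0 <= r < 1 -> exists M, forall k, Cmod (a k) * r ^ k <= M.

Lemma is_pseries_Cpow (a : nat -> C) (z l : C) :
  is_pseries (K := C_AbsRing) (V := C_NormedModule) a z l <->
  is_series (K := C_AbsRing) (V := C_NormedModule) (fun k => (a k * z ^ k)%C) l.
Proof.
  assert (H : forall k, scal (K := C_AbsRing) (V := C_NormedModule)
    (pow_n (K := C_AbsRing) z k) (a k) = (a k * z ^ k)%C).
  { intros k.
    assert (Hp : pow_n (K := C_AbsRing) z k = (z ^ k)%C).
    { induction k as [|k IH]; [reflexivity|].
      rewrite Cpow_S, <- IH; reflexivity. }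
    change (Cmult (pow_n (K := C_AbsRing) z k) (a k) = (a k * z ^ k)%C).
    rewrite Hp; apply Cmult_comm. }
  unfold is_pseries; split; apply is_series_ext; auto.
Qed.

Lemma CPSeries_unique (a : nat -> C) (z l : C) :
  is_pseries (K := C_AbsRing) (V := C_NormedModule) a z l -> CPSeries a z = l.
Proof.
  intros H.
  apply (@iota_unique C_AbsRing C_CompleteNormedModule); [|exact H].
  intros y Hy.
  exact (filterlim_locally_unique _ _ _ Hy H).
Qed.

Lemma ex_series_R_scal_geom (M q : R) : 0 <= q < 1 -> ex_series (fun k => M * q ^ k).
Proof.
  intros Hq.
  apply (ex_series_scal (V := R_NormedModule) M (fun k => q ^ k)).
  apply ex_series_geom; rewrite Rabs_pos_eq; lra.
Qed.

Lemma subgeometric_CPSeries (a : nat -> C) (z : C) :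
  subgeometric a -> in_E z ->
  is_series (K := C_AbsRing) (V := C_NormedModule) (fun k => (a k * z ^ k)%C)
    (CPSeries a z).
Proof.
  intros Ha Hz; unfold in_E in Hz.
  assert (H0 := Cmod_ge_0 z).
  pose (r := (Cmod z + 1) / 2).
  assert (Hr : 0 <= r < 1) by (unfold r; lra).
  assert (Hr0 : 0 < r) by (unfold r; lra).
  destruct (Ha r Hr) as [M HM].
  assert (Hq : 0 <= Cmod z / r < 1).
  { split; [apply Rdiv_le_0_compat; lra|].
    apply (Rmult_lt_reg_r r); [lra|].
    unfold Rdiv; rewrite Rmult_assoc, Rinv_l by lra; unfold r; lra. }
  destruct (@ex_series_le C_AbsRing C_CompleteNormedModule
    (fun k => (a k * z ^ k)%C) (fun k => M * (Cmod z / r) ^ k)) as [l Hl].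
  { intros k.
    change (Cmod (a k * z ^ k)%C <= M * (Cmod z / r) ^ k).
    rewrite Cmod_mult, Cmod_pow.
    replace (Cmod z ^ k) with (r ^ k * (Cmod z / r) ^ k)
      by (rewrite <- Rpow_mult_distr; f_equal; field; lra).
    rewrite <- Rmult_assoc.
    apply Rmult_le_compat_r; [apply pow_le; lra|apply HM]. }
  { apply ex_series_R_scal_geom; exact Hq. }
  replace (CPSeries a z) with l; [exact Hl|].
  symmetry; apply CPSeries_unique, is_pseries_Cpow; exact Hl.
Qed.

Lemma normalized_expansion_subgeometric (f : C -> C) (a : nat -> C) :
  normalized_expansion f a -> subgeometric a.
Proof.
  intros [_ [_ H]] r Hr.
  assert (Hz : in_E (RtoC r)) by (unfold in_E; rewrite Cmod_R, Rabs_pos_eq; lra).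
  specialize (H _ Hz); apply is_pseries_Cpow in H.
  destruct (filterlim_bounded (K := C_AbsRing) (V := C_NormedModule) _
    (ex_intro _ _ H)) as [M HM].
  (* A term is the difference of two consecutive partial sums, each bounded by [M]. *)
  exists (2 * M); intros k.
  rewrite <- (Rabs_pos_eq r) by lra.
  rewrite <- Cmod_R, <- Cmod_pow, <- Cmod_mult.
  assert (HM0 := HM 0%nat).
  destruct k as [|k].
  - rewrite sum_O in HM0.
    change (Cmod (a 0%nat * r ^ 0)%C <= M) in HM0.
    assert (H1 := Cmod_ge_0 (a 0%nat * r ^ 0)%C). lra.
  - assert (H1 := HM k); assert (H2 := HM (S k)).
    rewrite sum_Sn in H2.
    set (s := sum_n _ k) in *.
    change (Cmod s <= M) in H1.
    change (Cmod (s + a (S k) * r ^ (S k))%C <= M) in H2.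
    replace (a (S k) * r ^ (S k))%C with ((s + a (S k) * r ^ (S k)) + - s)%C by ring.
    eapply Rle_trans; [apply Cmod_triangle|].
    rewrite Cmod_opp; lra.
Qed.

Lemma subgeometric_shift (a : nat -> C) :
  subgeometric a -> subgeometric (fun k => a (S k)).
Proof.
  intros Ha r Hr.
  destruct (Req_dec r 0) as [->|Hr0].
  - exists (Cmod (a 1%nat)); intros [|k]; simpl.
    + lra.
    + rewrite Rmult_0_l, Rmult_0_r; apply Cmod_ge_0.
  - destruct (Ha r Hr) as [M HM]; exists (M / r); intros k.
    apply (Rmult_le_reg_r r); [lra|].
    replace (M / r * r) with M by (field; lra).
    specialize (HM (S k)); simpl in HM; lra.
Qed.

(** Each of the [k + 1] terms of the geometric sum up to [x ^ k] is at least [x ^ k], and the sum of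
    the whole series is [/ (1 - x)]. *)
Lemma S_mul_pow_le (x : R) (k : nat) : 0 <= x < 1 -> INR (S k) * x ^ k <= / (1 - x).
Proof.
  intros Hx.
  assert (H : INR (S k) * x ^ k <= sum_f_R0 (fun i => x ^ i) k).
  { induction k as [|k IH]; [simpl; lra|].
    rewrite tech5, S_INR, Rmult_plus_distr_r, Rmult_1_l.
    apply Rplus_le_compat_r.
    eapply Rle_trans; [|exact IH].
    apply Rmult_le_compat_l; [apply pos_INR|].
    assert (0 <= x ^ k) by (apply pow_le; lra).
    simpl; nra. }
  eapply Rle_trans; [exact H|].
  rewrite tech3 by lra.
  assert (0 <= x ^ S k) by (apply pow_le; lra).
  assert (0 < / (1 - x)) by (apply Rinv_0_lt_compat; lra).
  unfold Rdiv; nra.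
Qed.

Lemma subgeometric_le (K : R) (a b : nat -> C) :
  0 <= K -> subgeometric a -> (forall k, Cmod (b k) <= K * Cmod (a k)) -> subgeometric b.
Proof.
  intros HK Ha Hab r Hr; destruct (Ha r Hr) as [M HM].
  exists (K * M); intros k.
  apply Rle_trans with (K * (Cmod (a k) * r ^ k)).
  - rewrite <- Rmult_assoc.
    apply Rmult_le_compat_r; [apply pow_le; lra|apply Hab].
  - apply Rmult_le_compat_l; [exact HK|apply HM].
Qed.

(** The bound is taken at a radius [r'] between [r] and 1; the gap leaves a factor [(r / r') ^ k],
    which absorbs [k + 1]. *)
Lemma subgeometric_S_mul (a : nat -> C) :
  subgeometric a -> subgeometric (fun k => (RtoC (INR (S k)) * a k)%C).
Proof.
  intros Ha r Hr.
  pose (r' := (r + 1) / 2).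
  assert (Hr' : 0 <= r' < 1) by (unfold r'; lra).
  assert (Hr0 : 0 < r') by (unfold r'; lra).
  destruct (Ha r' Hr') as [M HM].
  assert (Hx : 0 <= r / r' < 1).
  { split; [apply Rdiv_le_0_compat; lra|].
    apply (Rmult_lt_reg_r r'); [lra|].
    unfold Rdiv; rewrite Rmult_assoc, Rinv_l by lra; unfold r'; lra. }
  exists (M * / (1 - r / r')); intros k.
  rewrite Cmod_mult, Cmod_R, Rabs_pos_eq by apply pos_INR.
  replace (r ^ k) with (r' ^ k * (r / r') ^ k)
    by (rewrite <- Rpow_mult_distr; f_equal; field; lra).
  replace (INR (S k) * Cmod (a k) * (r' ^ k * (r / r') ^ k))
    with ((Cmod (a k) * r' ^ k) * (INR (S k) * (r / r') ^ k)) by ring.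
  apply Rmult_le_compat; [| |apply HM|apply S_mul_pow_le, Hx].
  - apply Rmult_le_pos; [apply Cmod_ge_0|apply pow_le; lra].
  - apply Rmult_le_pos; [apply pos_INR|apply pow_le; lra].
Qed.

Lemma subgeometric_pow_mul (a : nat -> C) (N : nat) :
  subgeometric a -> subgeometric (fun k => (RtoC (INR (S k) ^ N) * a k)%C).
Proof.
  intros Ha; induction N as [|N IH].
  - apply (subgeometric_le 1 a); [lra|exact Ha|]; intros k; simpl pow.
    rewrite Cmult_1_l; lra.
  - apply (subgeometric_le 1 _ _ Rle_0_1 (subgeometric_S_mul _ IH)); intros k.
    change (INR (S k) ^ S N) with (INR (S k) * INR (S k) ^ N).
    rewrite RtoC_mult, Rmult_1_l; right; f_equal; ring.
Qed.

(** After taking logarithms, [sigma (ln 2 - ln (k + 1)) <= |sigma| ln 2 + N ln (k + 1)], whatever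
    the sign of [sigma]. An integer exponent [N] above [|sigma|] reduces the multiplier to
    polynomial growth. *)
Lemma multiplier_le (n N k : nat) (sigma : R) :
  Rabs sigma < INR N ->
  INR k ^ n * Rpower (2 / (INR k + 1)) sigma <= Rpower 2 (Rabs sigma) * INR (S k) ^ (n + N).
Proof.
  intros HN.
  assert (Hk := pos_INR k).
  assert (Hln2 := ln_lt_2).
  assert (Hlnk : 0 <= ln (INR k + 1)).
  { rewrite <- ln_1; apply ln_le; lra. }
  rewrite S_INR, pow_add.
  replace (Rpower 2 (Rabs sigma) * ((INR k + 1) ^ n * (INR k + 1) ^ N))
    with ((INR k + 1) ^ n * (Rpower 2 (Rabs sigma) * (INR k + 1) ^ N)) by ring.
  apply Rmult_le_compat.
  - apply pow_le, Hk.
  - left; apply exp_pos.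
  - apply pow_incr; lra.
  - rewrite <- (Rpower_pow N) by lra.
    unfold Rpower; rewrite <- exp_plus.
    apply Rnot_lt_le; intros Hlt; apply exp_lt_inv in Hlt.
    revert Hlt; apply Rle_not_lt.
    rewrite ln_div by lra.
    assert (H1 := Rle_abs sigma); assert (H2 := Rle_abs (- sigma)).
    rewrite Rabs_Ropp in H2.
    nra.
Qed.

Lemma subgeometric_multiplier (n : nat) (sigma : R) (a : nat -> C) :
  subgeometric a ->
  subgeometric (fun k => (RtoC (INR k ^ n * Rpower (2 / (INR k + 1)) sigma) * a k)%C).
Proof.
  intros Ha.
  destruct (INR_unbounded (Rabs sigma)) as [N HN].
  apply (subgeometric_le (Rpower 2 (Rabs sigma)) _ _ (Rlt_le _ _ (exp_pos _))
    (subgeometric_pow_mul _ (n + N) Ha)); intros k.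
  rewrite !Cmod_mult, !Cmod_R, <- Rmult_assoc.
  apply Rmult_le_compat_r; [apply Cmod_ge_0|].
  rewrite (Rabs_pos_eq (_ * _)), (Rabs_pos_eq (_ ^ _)).
  - apply multiplier_le; exact HN.
  - apply pow_le, pos_INR.
  - apply Rmult_le_pos; [apply pow_le, pos_INR|left; apply exp_pos].
Qed.

(** * Second-order Taylor estimate for power series *)

(* The second-order remainder [(z + h)^k - z^k - k h z^(k-1)], in a form without division. *)
Lemma Cpow_remainder_bound (z h : C) (r : R) (k : nat) :
  Cmod z <= r -> Cmod (z + h)%C <= r ->
  r ^ 2 * Cmod ((z + h) ^ k - z ^ k - RtoC (INR k) * h * z ^ (k - 1))%C
    <= Cmod h ^ 2 * (INR k ^ 2 * r ^ k).
Proof.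
  intros Hz Hzh.
  assert (H0 := Cmod_ge_0 z); assert (Hh := Cmod_ge_0 h).
  induction k as [|k IH].
  - replace ((z + h) ^ 0 - z ^ 0 - RtoC (INR 0) * h * z ^ (0 - 1))%C with (RtoC 0)
      by (simpl; ring).
    rewrite Cmod_0; simpl; lra.
  - set (e := ((z + h) ^ k - z ^ k - RtoC (INR k) * h * z ^ (k - 1))%C) in *.
    (* Multiplying the expansion of exponent [k] by [z + h] leaves the cross term [k h^2 z^(k-1)];
       the factor [k^2] of the bound propagates because [k^2 + k <= (k + 1)^2]. At [k = 0] the
       truncated exponent is harmless, its coefficient being 0. *)
    replace ((z + h) ^ S k - z ^ S k - RtoC (INR (S k)) * h * z ^ (S k - 1))%C
      with ((z + h) * e + RtoC (INR k) * h ^ 2 * z ^ (k - 1))%C.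
    2:{ unfold e; rewrite S_INR, RtoC_plus.
        replace (S k - 1)%nat with k by lia.
        destruct k as [|k]; [simpl; ring|].
        replace (S k - 1)%nat with k by lia.
        rewrite !Cpow_S; ring. }
    assert (He := Cmod_ge_0 e).
    assert (Hk := pos_INR k).
    assert (Hrk : 0 <= r ^ k) by (apply pow_le; lra).
    assert (A1 : Cmod ((z + h) * e)%C <= r * Cmod e).
    { rewrite Cmod_mult; apply Rmult_le_compat_r; assumption. }
    assert (A2 : r ^ 2 * Cmod (RtoC (INR k) * h ^ 2 * z ^ (k - 1))%C
                 <= INR k * Cmod h ^ 2 * r ^ S k).
    { rewrite !Cmod_mult, !Cmod_pow, Cmod_R, Rabs_pos_eq by assumption.
      destruct k as [|k]; [simpl; lra|].
      replace (S k - 1)%nat with k by lia.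
      replace (r ^ 2 * (INR (S k) * Cmod h ^ 2 * Cmod z ^ k))
        with (INR (S k) * Cmod h ^ 2 * (r ^ 2 * Cmod z ^ k)) by ring.
      apply Rmult_le_compat_l.
      - apply Rmult_le_pos; [assumption|apply pow_le; assumption].
      - replace (r ^ S (S k)) with (r ^ 2 * r ^ k) by (simpl; ring).
        apply Rmult_le_compat_l; [apply pow_le; lra|].
        apply pow_incr; lra. }
    assert (A3 := Cmod_triangle ((z + h) * e) (RtoC (INR k) * h ^ 2 * z ^ (k - 1))).
    set (X := Cmod ((z + h) * e + RtoC (INR k) * h ^ 2 * z ^ (k - 1))%C) in *.
    set (Y := Cmod (RtoC (INR k) * h ^ 2 * z ^ (k - 1))%C) in *.
    assert (B1 : r ^ 2 * X <= r * (r ^ 2 * Cmod e) + r ^ 2 * Y).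
    { replace (r * (r ^ 2 * Cmod e) + r ^ 2 * Y) with (r ^ 2 * (r * Cmod e + Y)) by ring.
      apply Rmult_le_compat_l; [apply pow_le|]; lra. }
    assert (B2 : r * (r ^ 2 * Cmod e) <= r * (Cmod h ^ 2 * (INR k ^ 2 * r ^ k)))
      by (apply Rmult_le_compat_l; lra).
    assert (B3 : 0 <= Cmod h ^ 2 * (r ^ S k * (INR k + 1))).
    { apply Rmult_le_pos; [apply pow_le; lra|].
      apply Rmult_le_pos; [apply pow_le; lra|lra]. }
    rewrite S_INR; simpl pow in *.
    nra.
Qed.

Lemma series_norm_le (a : nat -> C) (b : nat -> R) (l : C) (B : R) :
  is_series (K := C_AbsRing) (V := C_NormedModule) a l -> is_series b B ->
  (forall k, Cmod (a k) <= b k) -> Cmod l <= B.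
Proof.
  intros Ha Hb Hab.
  assert (H := filterlim_le (F := eventually)
    (fun n => norm (V := C_NormedModule) (sum_n (G := C_NormedModule) a n)) (sum_n b)
    (Finite (Cmod l)) (Finite B)).
  apply H; clear H.
  - apply filter_forall; intros n; unfold sum_n.
    eapply Rle_trans; [apply norm_sum_n_m|].
    apply sum_n_m_le; exact Hab.
  - apply (filterlim_comp _ _ _ _ _ _ (locally (l : C_NormedModule)) _ Ha).
    apply (filterlim_norm (V := C_NormedModule)).
  - exact Hb.
Qed.

Definition coef_deriv (a : nat -> C) (k : nat) : C := (RtoC (INR (S k)) * a (S k))%C.

Lemma subgeometric_deriv (a : nat -> C) : subgeometric a -> subgeometric (coef_deriv a).
Proof.
  intros Ha; exact (subgeometric_S_mul _ (subgeometric_shift _ Ha)).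
Qed.

(** The termwise remainders are at most [|h|^2 / r^2] times [k^2 |a k| r^k], and an intermediate
    radius [s] gives [k^2 |a k| r^k <= M (r / s)^k], a convergent majorant independent of [z] and
    [h]. *)
Lemma CPSeries_taylor (a : nat -> C) (r : R) :
  subgeometric a -> 0 < r < 1 ->
  exists M, forall z h : C, Cmod z <= r -> Cmod (z + h)%C <= r ->
    Cmod (CPSeries a (z + h) - CPSeries a z - h * CPSeries (coef_deriv a) z)%C
      <= M * Cmod h ^ 2.
Proof.
  intros Ha Hr.
  pose (s := (1 + r) / 2).
  assert (Hs : 0 < s < 1) by (unfold s; lra).
  destruct (subgeometric_pow_mul _ 2 Ha s ltac:(lra)) as [M HM].
  assert (Hq : 0 <= r / s < 1).
  { split; [apply Rdiv_le_0_compat; lra|].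
    apply (Rmult_lt_reg_r s); [lra|].
    unfold Rdiv; rewrite Rmult_assoc, Rinv_l by lra; unfold s; lra. }
  destruct (ex_series_R_scal_geom M (r / s) Hq) as [B HB].
  exists (B / r ^ 2); intros z h Hz Hzh.
  assert (Hz1 : in_E z) by (unfold in_E; lra).
  assert (Hzh1 : in_E (z + h)%C) by (unfold in_E; lra).
  assert (S1 := subgeometric_CPSeries _ _ Ha Hzh1).
  assert (S2 := subgeometric_CPSeries _ _ Ha Hz1).
  assert (S3 := subgeometric_CPSeries _ _ (subgeometric_deriv _ Ha) Hz1).
  (* The derivative series is reindexed to run parallel to the series of [a]; its added term at
     [k = 0] vanishes through the factor [INR 0]. *)
  assert (S4 : is_series (K := C_AbsRing) (V := C_NormedModule)
    (fun k => (RtoC (INR k) * a k * z ^ (k - 1))%C) (CPSeries (coef_deriv a) z)).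
  { apply (is_series_decr_1 (K := C_AbsRing) (V := C_NormedModule)).
    replace (plus (CPSeries (coef_deriv a) z) (opp _))
      with (CPSeries (coef_deriv a) z : C_NormedModule).
    - revert S3; apply is_series_ext; intros k; unfold coef_deriv.
      replace (S k - 1)%nat with k by lia; reflexivity.
    - change (CPSeries (coef_deriv a) z =
        (CPSeries (coef_deriv a) z + - (RtoC (INR 0) * a 0%nat * z ^ (0 - 1)))%C).
      simpl; ring. }
  apply (is_series_scal_l (K := C_AbsRing) (V := C_NormedModule) h) in S4.
  assert (S5 := is_series_minus _ _ _ _ (is_series_minus _ _ _ _ S1 S2) S4).
  assert (S6 : is_series (fun k => Cmod h ^ 2 / r ^ 2 * (M * (r / s) ^ k))
                 (Cmod h ^ 2 / r ^ 2 * B))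
    by exact (is_series_scal_l (V := R_NormedModule) (Cmod h ^ 2 / r ^ 2) _ _ HB).
  replace (B / r ^ 2 * Cmod h ^ 2) with (Cmod h ^ 2 / r ^ 2 * B) by (field; lra).
  refine (series_norm_le _ _ _ _ S5 S6 _); intros k.
  change (Cmod ((a k * (z + h) ^ k + - (a k * z ^ k))
    + - (h * (RtoC (INR k) * a k * z ^ (k - 1))))%C
    <= Cmod h ^ 2 / r ^ 2 * (M * (r / s) ^ k)).
  replace ((a k * (z + h) ^ k + - (a k * z ^ k)) + - (h * (RtoC (INR k) * a k * z ^ (k - 1))))%C
    with (a k * ((z + h) ^ k - z ^ k - RtoC (INR k) * h * z ^ (k - 1)))%C by ring.
  assert (Hb := Cpow_remainder_bound z h r k Hz Hzh).
  rewrite Cmod_mult.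
  set (e := Cmod ((z + h) ^ k - z ^ k - RtoC (INR k) * h * z ^ (k - 1))%C) in *.
  assert (Hr2 : 0 < r ^ 2) by (apply pow_lt; lra).
  apply (Rmult_le_reg_l (r ^ 2)); [exact Hr2|].
  replace (r ^ 2 * (Cmod h ^ 2 / r ^ 2 * (M * (r / s) ^ k)))
    with (Cmod h ^ 2 * (M * (r / s) ^ k)) by (field; lra).
  assert (Hak := Cmod_ge_0 (a k)).
  apply Rle_trans with (Cmod (a k) * (Cmod h ^ 2 * (INR k ^ 2 * r ^ k))).
  { replace (r ^ 2 * (Cmod (a k) * e)) with (Cmod (a k) * (r ^ 2 * e)) by ring.
    apply Rmult_le_compat_l; assumption. }
  replace (Cmod (a k) * (Cmod h ^ 2 * (INR k ^ 2 * r ^ k)))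
    with (Cmod h ^ 2 * ((INR k ^ 2 * Cmod (a k) * s ^ k) * (r / s) ^ k)).
  2:{ replace (r ^ k) with (s ^ k * (r / s) ^ k)
        by (rewrite <- Rpow_mult_distr; f_equal; field; lra).
      ring. }
  apply Rmult_le_compat_l; [apply pow_le, Cmod_ge_0|].
  apply Rmult_le_compat_r; [apply pow_le; lra|].
  eapply Rle_trans; [|apply (HM k)].
  apply Rmult_le_compat_r; [apply pow_le; lra|].
  rewrite Cmod_mult, Cmod_R, Rabs_pos_eq by (apply pow_le, pos_INR).
  apply Rmult_le_compat_r; [assumption|].
  apply pow_incr; split; [apply pos_INR|apply le_INR; lia].
Qed.

(** * Differentiability in the disk and real derivatives along segments *)

(** Complex differentiability with derivative [f'], in the quadratic form, uniform on closed
    subdisks, that power series supply. *)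
Definition diff_E (f f' : C -> C) : Prop :=
  forall r, 0 < r < 1 -> exists M, forall z h : C, Cmod z <= r -> Cmod (z + h)%C <= r ->
    Cmod (f (z + h) - f z - h * f' z)%C <= M * Cmod h ^ 2.

(** The operator [D u = z u'] as a relation, so that it constrains functions on the disk only. *)
Definition euler (f g : C -> C) : Prop :=
  exists f', diff_E f f' /\ forall z, in_E z -> g z = (z * f' z)%C.

Lemma diff_E_little_o (f f' : C -> C) (z v : C) (eps : R) :
  diff_E f f' -> in_E z -> 0 < eps ->
  exists d, 0 < d /\ forall s : R, Rabs s < d ->
    Cmod (f (z + RtoC s * v) - f z - RtoC s * (v * f' z))%C <= eps * Rabs s.
Proof.
  intros Hf Hz Heps; unfold in_E in Hz.
  assert (H0 := Cmod_ge_0 z); assert (Hv := Cmod_ge_0 v).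
  pose (r := (Cmod z + 1) / 2).
  destruct (Hf r ltac:(unfold r; lra)) as [M HM].
  assert (HK : 0 < Rabs M * Cmod v ^ 2 + 1).
  { assert (0 <= Rabs M * Cmod v ^ 2); [|lra].
    apply Rmult_le_pos; [apply Rabs_pos|apply pow_le, Hv]. }
  assert (Hd1 : 0 < (r - Cmod z) / (Cmod v + 1)).
  { apply Rdiv_lt_0_compat; unfold r; lra. }
  assert (Hd2 : 0 < eps / (Rabs M * Cmod v ^ 2 + 1)) by (apply Rdiv_lt_0_compat; lra).
  exists (Rmin ((r - Cmod z) / (Cmod v + 1)) (eps / (Rabs M * Cmod v ^ 2 + 1))).
  split; [apply Rmin_pos; assumption|]; intros s Hs.
  assert (Hs1 := Rlt_le_trans _ _ _ Hs (Rmin_l _ _)).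
  assert (Hs2 := Rlt_le_trans _ _ _ Hs (Rmin_r _ _)).
  assert (Hs0 := Rabs_pos s).
  apply (Rmult_lt_compat_r (Cmod v + 1)) in Hs1; [|lra].
  unfold Rdiv in Hs1; rewrite Rmult_assoc, Rinv_l, Rmult_1_r in Hs1 by lra.
  apply (Rmult_lt_compat_r (Rabs M * Cmod v ^ 2 + 1)) in Hs2; [|lra].
  unfold Rdiv in Hs2; rewrite Rmult_assoc, Rinv_l, Rmult_1_r in Hs2 by lra.
  assert (Hm : Cmod (RtoC s * v)%C = Rabs s * Cmod v) by (rewrite Cmod_mult, Cmod_R; reflexivity).
  specialize (HM z (RtoC s * v)%C).
  rewrite Hm in HM.
  replace (f (z + RtoC s * v) - f z - RtoC s * (v * f' z))%C
    with (f (z + RtoC s * v) - f z - RtoC s * v * f' z)%C by ring.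
  eapply Rle_trans; [apply HM|].
  - unfold r; lra.
  - eapply Rle_trans; [apply Cmod_triangle|]; rewrite Hm; nra.
  - replace (M * (Rabs s * Cmod v) ^ 2) with ((M * (Rabs s * Cmod v ^ 2)) * Rabs s) by ring.
    apply Rmult_le_compat_r; [assumption|].
    assert (M <= Rabs M) by apply Rle_abs.
    assert (0 <= Rabs s * Cmod v ^ 2) by (apply Rmult_le_pos; [|apply pow_le]; lra).
    nra.
Qed.

Lemma diff_E_derive (f f' : C -> C) (z v : C) (t : R) :
  diff_E f f' -> in_E (z + RtoC t * v)%C ->
  is_derive (fun s : R => Re (f (z + RtoC s * v)%C)) t (Re (v * f' (z + RtoC t * v))%C) /\
  is_derive (fun s : R => Im (f (z + RtoC s * v)%C)) t (Im (v * f' (z + RtoC t * v))%C).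
Proof.
  intros Hf Hz.
  set (w := (z + RtoC t * v)%C) in *.
  assert (key : forall eps : R, 0 < eps -> exists d : posreal, forall h : R,
    h <> 0 -> Rabs h < d ->
    Rabs ((Re (f (z + RtoC (t + h) * v)%C) - Re (f w)) / h - Re (v * f' w)%C) < eps /\
    Rabs ((Im (f (z + RtoC (t + h) * v)%C) - Im (f w)) / h - Im (v * f' w)%C) < eps).
  { intros eps Heps.
    destruct (diff_E_little_o f f' w v (eps / 2) Hf Hz ltac:(lra)) as [d [Hd H]].
    exists (mkposreal d Hd); intros h Hh0 Hh; simpl in Hh.
    specialize (H h Hh).
    replace (w + RtoC h * v)%C with (z + RtoC (t + h) * v)%C in H
      by (unfold w; rewrite RtoC_plus; ring).
    assert (Hp := Rabs_pos_lt h Hh0).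
    set (e := (f (z + RtoC (t + h) * v) - f w - RtoC h * (v * f' w))%C) in *.
    assert (H1 := Rle_trans _ _ _ (Rmax_l _ _) (Rmax_Cmod e)).
    assert (H2 := Rle_trans _ _ _ (Rmax_r _ _) (Rmax_Cmod e)).
    assert (E1 : fst e = Re (f (z + RtoC (t + h) * v)%C) - Re (f w) - h * Re (v * f' w)%C).
    { unfold e, Re; simpl; ring. }
    assert (E2 : snd e = Im (f (z + RtoC (t + h) * v)%C) - Im (f w) - h * Im (v * f' w)%C).
    { unfold e, Im; simpl; ring. }
    rewrite E1 in H1; rewrite E2 in H2.
    split; apply (Rmult_lt_reg_r (Rabs h)); try exact Hp; rewrite <- Rabs_mult;
      rewrite Rmult_minus_distr_r; unfold Rdiv; rewrite Rmult_assoc, Rinv_l, Rmult_1_r by exact Hh0;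
      rewrite (Rmult_comm _ h); nra. }
  split; apply is_derive_Reals; intros eps Heps; destruct (key eps Heps) as [d Hd];
    exists d; intros h Hh0 Hh; apply (Hd h Hh0 Hh).
Qed.

Lemma continuous_C_of_dist (f : C -> C) (z : C) :
  (forall eps, 0 < eps -> exists d, 0 < d /\ forall h, Cmod h < d ->
     Cmod (f (z + h) - f z)%C < eps) ->
  @continuous C_UniformSpace C_UniformSpace f z.
Proof.
  intros H; apply (filterlim_locally_ball_norm (K := C_AbsRing) (U := C_NormedModule)).
  intros eps.
  apply (@locally_le_locally_norm C_AbsRing C_NormedModule).
  destruct (H eps (cond_pos eps)) as [d [Hd Hh]].
  exists (mkposreal d Hd); intros w Hw.
  change (Cmod (w - z)%C < d) in Hw.
  change (Cmod (f w - f z)%C < eps).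
  replace w with (z + (w - z))%C at 1 by ring.
  apply Hh, Hw.
Qed.

Lemma diff_E_continuous (f f' : C -> C) (z : C) :
  diff_E f f' -> in_E z -> @continuous C_UniformSpace C_UniformSpace f z.
Proof.
  intros Hf Hz; apply continuous_C_of_dist; intros eps Heps; unfold in_E in Hz.
  assert (H0 := Cmod_ge_0 z).
  pose (r := (Cmod z + 1) / 2).
  destruct (Hf r ltac:(unfold r; lra)) as [M HM].
  assert (HK : 0 < Cmod (f' z) + Rabs M + 1).
  { assert (H1 := Cmod_ge_0 (f' z)); assert (H2 := Rabs_pos M); lra. }
  assert (Hd2 : 0 < eps / (Cmod (f' z) + Rabs M + 1)) by (apply Rdiv_lt_0_compat; lra).
  exists (Rmin (r - Cmod z) (eps / (Cmod (f' z) + Rabs M + 1))).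
  split; [apply Rmin_pos; unfold r in *; lra|]; intros h Hh.
  assert (Hh1 := Rlt_le_trans _ _ _ Hh (Rmin_l _ _)).
  assert (Hh2 := Rlt_le_trans _ _ _ Hh (Rmin_r _ _)).
  apply (Rmult_lt_compat_r (Cmod (f' z) + Rabs M + 1)) in Hh2; [|lra].
  unfold Rdiv in Hh2; rewrite Rmult_assoc, Rinv_l, Rmult_1_r in Hh2 by lra.
  assert (Hh0 := Cmod_ge_0 h).
  assert (Hzh : Cmod (z + h)%C <= r).
  { eapply Rle_trans; [apply Cmod_triangle|]; lra. }
  specialize (HM z h ltac:(unfold r; lra) Hzh).
  replace (f (z + h) - f z)%C with ((f (z + h) - f z - h * f' z) + h * f' z)%C by ring.
  eapply Rle_lt_trans; [apply Cmod_triangle|]; rewrite Cmod_mult.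
  assert (Cmod h <= 1) by (unfold r in *; lra).
  assert (M <= Rabs M) by apply Rle_abs.
  assert (HM2 := Rabs_pos M).
  assert (M * Cmod h ^ 2 <= Rabs M * Cmod h).
  { simpl; rewrite Rmult_1_r, <- Rmult_assoc.
    apply Rle_trans with (Rabs M * Cmod h * Cmod h).
    - apply Rmult_le_compat_r; [assumption|]; apply Rmult_le_compat_r; assumption.
    - rewrite <- (Rmult_1_r (Rabs M * Cmod h)) at 2.
      apply Rmult_le_compat_l; [apply Rmult_le_pos|]; assumption. }
  nra.
Qed.

(** * First failure of positivity, inward and radial derivatives *)

Lemma locally_C_box (z : C) (P : C -> Prop) :
  locally (T := C_UniformSpace) z P ->
  exists d : posreal, forall w : C,
    Rabs (Re w - Re z) < d -> Rabs (Im w - Im z) < d -> P w.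
Proof.
  intros [d Hd]; exists d; intros w H1 H2; apply Hd; split; assumption.
Qed.

Lemma continuous_pos_box (u : C -> R) (z : C) :
  @continuous C_UniformSpace R_UniformSpace u z -> 0 < u z ->
  exists d : posreal, forall w : C,
    Rabs (Re w - Re z) < d -> Rabs (Im w - Im z) < d -> 0 < u w.
Proof.
  intros Hu Hz; apply locally_C_box.
  apply (Hu (fun x => 0 < x)).
  exact (open_gt 0 (u z) Hz).
Qed.

Lemma Cmod_le_minus_plus (p z : C) : Cmod p <= Cmod (p - z)%C + Cmod z.
Proof.
  replace p with ((p - z) + z)%C at 1 by ring; apply Cmod_triangle.
Qed.

(** Take the supremum [R0] of the radii, up to [|z1|], of open disks on which [u > 0]. If [u] were
    positive on the whole circle of radius [R0], compactness would enlarge the disk; so [u <= 0]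
    somewhere on that circle, and continuity from inside gives equality there. *)
Lemma first_nonpositive (u : C -> R) (z1 : C) :
  (forall z, in_E z -> @continuous C_UniformSpace R_UniformSpace u z) ->
  0 < u (RtoC 0) -> in_E z1 -> u z1 <= 0 ->
  exists z0, in_E z0 /\ z0 <> RtoC 0 /\ u z0 = 0 /\ forall z, Cmod z < Cmod z0 -> 0 < u z.
Proof.
  intros Hu Hu0 Hz1 Hu1; unfold in_E in *.
  pose (good := fun rho => rho <= Cmod z1 /\ forall z, Cmod z < rho -> 0 < u z).
  destruct (completeness good) as [R0 [HR1 HR2]].
  { exists (Cmod z1); intros x [Hx _]; exact Hx. }
  { exists 0; split; [apply Cmod_ge_0|]; intros z Hz.
    assert (H := Cmod_ge_0 z); lra. }
  assert (HR0 : R0 <= Cmod z1) by (apply HR2; intros x [Hx _]; exact Hx).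
  assert (Hin : forall z, Cmod z < R0 -> 0 < u z).
  { intros z Hz; apply Rnot_le_lt; intros Hneg.
    assert (R0 <= Cmod z); [|lra].
    apply HR2; intros x [_ Hx]; apply Rnot_lt_le; intros Hlt.
    specialize (Hx z Hlt); lra. }
  assert (Hex : exists z0, Cmod z0 = R0 /\ u z0 <= 0).
  { apply NNPP; intros Hno.
    assert (Hle : forall z, Cmod z <= R0 -> 0 < u z).
    { intros z [Hz|Hz]; [apply Hin, Hz|].
      apply Rnot_le_lt; intros Hneg; apply Hno; exists z; split; assumption. }
    assert (HRlt : R0 < Cmod z1).
    { destruct HR0 as [H|H]; [exact H|].
      specialize (Hle z1 ltac:(lra)); lra. }
    (* A gauge for the compactness of the square. Boxes tagged outside the closed disk must miss all
       points within [d] of it: with [d] at most the gauge, the box contributes at most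
       [sqrt 2 <= 2] gauges and the margin one more, which 4 exceeds. *)
    assert (Hdelta : forall p : C, exists d : posreal,
      (Cmod p <= R0 -> forall w : C,
         Rabs (Re w - Re p) < d -> Rabs (Im w - Im p) < d -> 0 < u w) /\
      (R0 < Cmod p -> 4 * d <= Cmod p - R0)).
    { intros p; destruct (Rle_lt_dec (Cmod p) R0) as [Hp|Hp].
      - destruct (continuous_pos_box u p) as [d Hd].
        + apply Hu; lra.
        + apply Hle, Hp.
        + exists d; split; [intros _; exact Hd|lra].
      - assert (H4 : 0 < (Cmod p - R0) / 4) by lra.
        exists (mkposreal _ H4); simpl; split; lra. }
    pose (delta := fun x y => proj1_sig (constructive_indefinite_description _ (Hdelta (x, y)))).
    destruct (compactness_value_2d (-1) 1 (-1) 1 delta) as [d Hd].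
    assert (Hdpos := cond_pos d).
    pose (rho := Rmin (R0 + d) (Cmod z1)).
    assert (Hrho : R0 < rho) by (unfold rho; apply Rmin_glb_lt; lra).
    assert (HS : good rho).
    { split; [apply Rmin_r|]; intros z Hz.
      assert (Hza := Rlt_le_trans _ _ _ Hz (Rmin_l _ _)).
      assert (Hzb := Rlt_le_trans _ _ _ Hz (Rmin_r _ _)).
      assert (M1 := Rle_trans _ _ _ (Rmax_l _ _) (Rmax_Cmod z)).
      assert (M2 := Rle_trans _ _ _ (Rmax_r _ _) (Rmax_Cmod z)).
      apply Rnot_le_lt; intros Hneg.
      apply (Hd (fst z) (snd z)).
      { apply Rabs_le_between; lra. }
      { apply Rabs_le_between; lra. }
      intros (x & y & _ & _ & H1 & H2 & H3).
      unfold delta in *.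
      destruct (constructive_indefinite_description _ (Hdelta (x, y))) as [dd [K1 K2]]; simpl in *.
      destruct (Rle_lt_dec (Cmod (x, y)) R0) as [Hp|Hp].
      - specialize (K1 Hp z H1 H2); lra.
      - specialize (K2 Hp).
        assert (Htri := Cmod_le_minus_plus (x, y) z).
        assert (Hsq := Cmod_2Rmax ((x, y) - z)%C).
        assert (Hmax : Rmax (Rabs (fst ((x, y) - z)%C)) (Rabs (snd ((x, y) - z)%C)) <= dd).
        { apply Rmax_lub; simpl.
          - rewrite Rabs_minus_sym in H1; left; exact H1.
          - rewrite Rabs_minus_sym in H2; left; exact H2. }
        assert (Hs2 : sqrt 2 <= 2).
        { rewrite <- (sqrt_square 2) at 2 by lra; apply sqrt_le_1; lra. }
        assert (Hs0 := sqrt_pos 2).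
        assert (Hdd := cond_pos dd).
        assert (sqrt 2 * Rmax (Rabs (fst ((x, y) - z)%C)) (Rabs (snd ((x, y) - z)%C)) <= 2 * dd).
        { apply Rmult_le_compat; try assumption.
          eapply Rle_trans; [apply Rabs_pos|apply Rmax_l]. }
        lra. }
    specialize (HR1 rho HS); lra. }
  destruct Hex as [z0 [Hz0 Hneg]].
  assert (Hz0E : Cmod z0 < 1) by lra.
  assert (Hne : z0 <> RtoC 0) by (intros E; rewrite E in Hneg; lra).
  exists z0; split; [exact Hz0E|]; split; [exact Hne|]; split.
  2:{ intros z Hz; apply Hin; lra. }
  apply Rle_antisym; [exact Hneg|].
  apply Rnot_lt_le; intros Hlt.
  (* Were [u z0 < 0], [u] would also be negative at the interior point [(1 - t) z0] for small
     [t]. *)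
  destruct (continuous_pos_box (fun z => - u z) z0) as [d Hd].
  { apply (continuous_opp (V := R_NormedModule)), Hu, Hz0E. }
  { lra. }
  assert (Hp : 0 < Cmod z0) by (apply Cmod_gt_0; exact Hne).
  assert (Hdp := cond_pos d).
  pose (t := Rmin (1 / 2) (d / 2)).
  assert (Ht : 0 < t <= 1 / 2).
  { split; [apply Rmin_pos; lra|apply Rmin_l]. }
  assert (Htd : t < d).
  { apply Rle_lt_trans with (d / 2); [apply Rmin_r|lra]. }
  assert (M1 := Rle_trans _ _ _ (Rmax_l _ _) (Rmax_Cmod z0)).
  assert (M2 := Rle_trans _ _ _ (Rmax_r _ _) (Rmax_Cmod z0)).
  assert (Hw1 : 0 < u (RtoC (1 - t) * z0)%C).
  { apply Hin; rewrite Cmod_mult, Cmod_R, Rabs_pos_eq by lra; nra. }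
  assert (Hw2 : 0 < - u (RtoC (1 - t) * z0)%C).
  { apply Hd.
    - replace (Re (RtoC (1 - t) * z0)%C - Re z0) with (- t * fst z0) by (unfold Re; simpl; ring).
      rewrite Rabs_mult, Rabs_Ropp, (Rabs_pos_eq t) by lra; nra.
    - replace (Im (RtoC (1 - t) * z0)%C - Im z0) with (- t * snd z0) by (unfold Im; simpl; ring).
      rewrite Rabs_mult, Rabs_Ropp, (Rabs_pos_eq t) by lra; nra. }
  lra.
Qed.

(* For small [t > 0] the point [z0 (1 - t c)] lies inside the circle through [z0]. *)
Lemma inward_derivative_nonneg (u : C -> R) (z0 c : C) (d : R) :
  z0 <> RtoC 0 -> 0 < Re c -> u z0 = 0 ->
  (forall z, z <> RtoC 0 -> Cmod z < Cmod z0 -> 0 < u z) ->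
  is_derive (fun t : R => u (z0 + RtoC t * - (c * z0))%C) 0 d -> 0 <= d.
Proof.
  intros Hz0 Hc Hu0 Hu Hd.
  apply is_derive_Reals in Hd.
  apply Rnot_lt_le; intros Hneg.
  destruct (Hd (- d) ltac:(lra)) as [e He].
  assert (Hep := cond_pos e).
  assert (Hc0 : 0 < Cmod c).
  { apply Cmod_gt_0; intros E; rewrite E in Hc; simpl in Hc; lra. }
  assert (Hc2 : 0 < Cmod c ^ 2) by (apply pow_lt; exact Hc0).
  (* The bounds serve in turn: the difference quotient is within [- d] of [d], hence negative;
     [1 - t c] is not 0; and [|1 - t c|^2 <= 1 - t Re c < 1]. *)
  pose (t := Rmin (e / 2) (Rmin (1 / (2 * Cmod c)) (Re c / Cmod c ^ 2))).
  assert (H1 : 0 < t).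
  { unfold t; apply Rmin_pos; [lra|]; apply Rmin_pos; apply Rdiv_lt_0_compat; lra. }
  assert (H2 : t < e).
  { apply Rle_lt_trans with (e / 2); [apply Rmin_l|lra]. }
  assert (H3 : t * Cmod c < 1).
  { assert (H : t <= 1 / (2 * Cmod c)) by (eapply Rle_trans; [apply Rmin_r|apply Rmin_l]).
    apply (Rmult_le_compat_r (Cmod c)) in H; [|lra].
    replace (1 / (2 * Cmod c) * Cmod c) with (1 / 2) in H by (field; lra); lra. }
  assert (H4 : t * Cmod c ^ 2 <= Re c).
  { assert (H : t <= Re c / Cmod c ^ 2) by (eapply Rle_trans; [apply Rmin_r|apply Rmin_r]).
    apply (Rmult_le_compat_r (Cmod c ^ 2)) in H; [|lra].
    replace (Re c / Cmod c ^ 2 * Cmod c ^ 2) with (Re c) in H by (field; lra); lra. }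
  specialize (He t ltac:(lra) ltac:(rewrite Rabs_pos_eq; lra)).
  rewrite Rplus_0_l in He.
  assert (Hin : 0 < u (z0 + RtoC t * - (c * z0))%C).
  { replace (z0 + RtoC t * - (c * z0))%C with (z0 * (1 - RtoC t * c))%C by ring.
    assert (Hz0p : 0 < Cmod z0) by (apply Cmod_gt_0; exact Hz0).
    apply Hu.
    - apply Cmult_neq_0; [exact Hz0|]; intros E.
      assert (E' : (RtoC t * c)%C = RtoC 1).
      { replace (RtoC t * c)%C with (1 - (1 - RtoC t * c))%C by ring; rewrite E; ring. }
      apply (f_equal Cmod) in E'.
      rewrite Cmod_mult, Cmod_R, Cmod_1, Rabs_pos_eq in E' by lra; lra.
    - rewrite Cmod_mult.
      assert (Hlt : Cmod (1 - RtoC t * c)%C < 1).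
      { apply (Rsqr_incrst_0 _ 1); [|apply Cmod_ge_0|lra].
        rewrite !Rsqr_pow2, Cmod2_alt.
        replace (Re (1 - RtoC t * c)%C) with (1 - t * Re c) by (unfold Re; simpl; ring).
        replace (Im (1 - RtoC t * c)%C) with (- (t * Im c)) by (unfold Im; simpl; ring).
        rewrite Cmod2_alt in H4.
        assert (t * (t * (Re c ^ 2 + Im c ^ 2)) <= t * Re c)
          by (apply Rmult_le_compat_l; lra).
        nra. }
      nra. }
  replace (z0 + RtoC 0 * - (c * z0))%C with z0 in He by ring.
  rewrite Hu0, Rminus_0_r in He.
  assert (0 < u (z0 + RtoC t * - (c * z0))%C / t) by (apply Rdiv_lt_0_compat; assumption).
  rewrite Rabs_pos_eq in He; lra.
Qed.

(** At [t z0] one has [t d/dt |f|^2 = 2 Re (g conj f)], so by the mean value theorem [|f|^2] at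
    [t = 1] cannot fall below its positive value at [t = a]. *)
Lemma radial_nonvanishing (f g : C -> C) (z0 : C) (a : R) :
  euler f g -> in_E z0 -> 0 < a < 1 ->
  (forall t : R, a <= t < 1 ->
     f (RtoC t * z0)%C <> RtoC 0 /\
     0 <= Re (g (RtoC t * z0) * Cconj (f (RtoC t * z0)))%C) ->
  f z0 <> RtoC 0.
Proof.
  intros [f' [Hf Hg]] Hz0 Ha H E; unfold in_E in *.
  assert (Hz0' := Cmod_ge_0 z0).
  pose (phi := fun t : R => Re (f (RtoC 0 + RtoC t * z0)%C) ^ 2 + Im (f (RtoC 0 + RtoC t * z0)%C) ^ 2).
  pose (dphi := fun t : R =>
    2 * (Re (f (RtoC 0 + RtoC t * z0)%C) * Re (z0 * f' (RtoC 0 + RtoC t * z0))%C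
       + Im (f (RtoC 0 + RtoC t * z0)%C) * Im (z0 * f' (RtoC 0 + RtoC t * z0))%C)).
  assert (HE : forall t, a <= t <= 1 -> in_E (RtoC 0 + RtoC t * z0)%C).
  { intros t Ht; unfold in_E; rewrite Cplus_0_l, Cmod_mult, Cmod_R, Rabs_pos_eq by lra; nra. }
  destruct (MVT_cor2 phi dphi a 1) as [t [Ht1 Ht2]]; [lra| |].
  { intros t Ht; apply is_derive_Reals.
    destruct (diff_E_derive f f' (RtoC 0) z0 t Hf (HE t Ht)) as [D1 D2].
    unfold phi, dphi.
    evar_last.
    { apply @is_derive_plus; apply is_derive_pow; [exact D1|exact D2]. }
    unfold plus; simpl; ring. }
  assert (Hphi1 : phi 1 = 0).
  { unfold phi; rewrite Cplus_0_l, Cmult_1_l, E; simpl; ring. }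
  assert (Hphia : 0 < phi a).
  { unfold phi; rewrite Cplus_0_l, <- Cmod2_alt; apply pow_lt, Cmod_gt_0, H; lra. }
  assert (Hd : 0 <= dphi t).
  { destruct (H t ltac:(lra)) as [_ Hre].
    specialize (HE t ltac:(lra)).
    unfold dphi; rewrite Cplus_0_l in *.
    rewrite Hg in Hre by exact HE.
    set (w := (RtoC t * z0)%C) in *.
    replace (Re (w * f' w * Cconj (f w))%C)
      with (t * (Re (f w) * Re (z0 * f' w)%C + Im (f w) * Im (z0 * f' w)%C)) in Hre.
    2:{ unfold w; rewrite <- Cmult_assoc; unfold Cconj, Re, Im; simpl; ring. }
    assert (0 < t) by lra.
    nra. }
  assert (0 <= dphi t * (1 - a)) by (apply Rmult_le_pos; lra).
  lra.
Qed.

(** * Complex quotients in real coordinates: derivative and continuity *)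

Lemma Re_Cdiv (a b : C) :
  Re (a / b)%C = (Re a * Re b + Im a * Im b) / (Re b ^ 2 + Im b ^ 2).
Proof. unfold Re, Im; simpl; unfold Rdiv; ring. Qed.

Lemma Im_Cdiv (a b : C) :
  Im (a / b)%C = (Im a * Re b - Re a * Im b) / (Re b ^ 2 + Im b ^ 2).
Proof. unfold Re, Im; simpl; unfold Rdiv; ring. Qed.

Lemma Re_Im_sqr_pos (b : C) : b <> RtoC 0 -> 0 < Re b ^ 2 + Im b ^ 2.
Proof. intros H; rewrite <- Cmod2_alt; apply pow_lt, Cmod_gt_0, H. Qed.

Lemma is_derive_Re_Cdiv (A B : R -> C) (t : R) (a b : C) :
  B t <> RtoC 0 ->
  is_derive (fun s => Re (A s)) t (Re a) -> is_derive (fun s => Im (A s)) t (Im a) ->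
  is_derive (fun s => Re (B s)) t (Re b) -> is_derive (fun s => Im (B s)) t (Im b) ->
  is_derive (fun s => Re (A s / B s)%C) t (Re ((a * B t - A t * b) / (B t * B t))%C).
Proof.
  intros HB Ar Ai Br Bi.
  assert (Hpos := Re_Im_sqr_pos _ HB).
  apply (is_derive_ext (fun s => (Re (A s) * Re (B s) + Im (A s) * Im (B s))
    / (Re (B s) ^ 2 + Im (B s) ^ 2))).
  { intros s; symmetry; apply Re_Cdiv. }
  evar_last.
  { apply is_derive_div.
    - apply @is_derive_plus; apply Derive.is_derive_mult; eassumption.
    - apply @is_derive_plus; apply is_derive_pow; eassumption.
    - apply Rgt_not_eq, Hpos. }
  rewrite Re_Cdiv; unfold plus; simpl.
  revert Hpos; destruct (A t) as [x1 x2], (B t) as [y1 y2], a as [a1 a2], b as [b1 b2].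
  unfold Re, Im; simpl; intros Hpos.
  field; split; [|lra].
  (* The remaining denominator is [|b^2|^2 = (|b|^2)^2] with [b = B t]. *)
  replace ((y1 * y1 - y2 * y2) * ((y1 * y1 - y2 * y2) * 1) +
    (y1 * y2 + y2 * y1) * ((y1 * y2 + y2 * y1) * 1))
    with ((y1 * (y1 * 1) + y2 * (y2 * 1)) * (y1 * (y1 * 1) + y2 * (y2 * 1))) by ring.
  nra.
Qed.

Lemma continuous_Re (f : C -> C) (z : C) :
  @continuous C_UniformSpace C_UniformSpace f z ->
  @continuous C_UniformSpace R_UniformSpace (fun w => Re (f w)) z.
Proof.
  intros Hf; apply (@continuous_comp C_UniformSpace C_UniformSpace R_UniformSpace f fst z Hf).
  destruct (f z) as [x y]; exact (continuous_fst x y).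
Qed.

Lemma continuous_Im (f : C -> C) (z : C) :
  @continuous C_UniformSpace C_UniformSpace f z ->
  @continuous C_UniformSpace R_UniformSpace (fun w => Im (f w)) z.
Proof.
  intros Hf; apply (@continuous_comp C_UniformSpace C_UniformSpace R_UniformSpace f snd z Hf).
  destruct (f z) as [x y]; exact (continuous_snd x y).
Qed.

Lemma continuous_C_of_Re_Im (f : C -> C) (z : C) :
  @continuous C_UniformSpace R_UniformSpace (fun w => Re (f w)) z ->
  @continuous C_UniformSpace R_UniformSpace (fun w => Im (f w)) z ->
  @continuous C_UniformSpace C_UniformSpace f z.
Proof.
  intros H1 H2; apply filterlim_locally; intros eps.
  apply filterlim_locally with (eps := eps) in H1.
  apply filterlim_locally with (eps := eps) in H2.
  generalize (filter_and _ _ H1 H2); apply filter_imp.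
  intros w [B1 B2]; split; assumption.
Qed.

Lemma continuous_R_mult (f g : C -> R) (z : C) :
  @continuous C_UniformSpace R_UniformSpace f z ->
  @continuous C_UniformSpace R_UniformSpace g z ->
  @continuous C_UniformSpace R_UniformSpace (fun w => f w * g w) z.
Proof. exact (continuous_mult (K := R_AbsRing) f g z). Qed.

Lemma continuous_R_plus (f g : C -> R) (z : C) :
  @continuous C_UniformSpace R_UniformSpace f z ->
  @continuous C_UniformSpace R_UniformSpace g z ->
  @continuous C_UniformSpace R_UniformSpace (fun w => f w + g w) z.
Proof. exact (continuous_plus (V := R_NormedModule) f g z). Qed.

Lemma continuous_R_minus (f g : C -> R) (z : C) :
  @continuous C_UniformSpace R_UniformSpace f z ->
  @continuous C_UniformSpace R_UniformSpace g z ->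
  @continuous C_UniformSpace R_UniformSpace (fun w => f w - g w) z.
Proof. exact (continuous_minus (V := R_NormedModule) f g z). Qed.

Lemma continuous_R_div (f g : C -> R) (z : C) :
  @continuous C_UniformSpace R_UniformSpace f z ->
  @continuous C_UniformSpace R_UniformSpace g z -> g z <> 0 ->
  @continuous C_UniformSpace R_UniformSpace (fun w => f w / g w) z.
Proof.
  intros Hf Hg Hz; apply continuous_R_mult; [exact Hf|].
  apply (@continuous_comp C_UniformSpace R_UniformSpace R_UniformSpace g Rinv z Hg).
  apply continuous_Rinv, Hz.
Qed.

Lemma continuous_Cdiv (f g : C -> C) (z : C) :
  @continuous C_UniformSpace C_UniformSpace f z ->
  @continuous C_UniformSpace C_UniformSpace g z -> g z <> RtoC 0 ->
  @continuous C_UniformSpace C_UniformSpace (fun w => f w / g w)%C z.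
Proof.
  intros Hf Hg Hz.
  assert (Hpos := Re_Im_sqr_pos _ Hz).
  assert (Hfr := continuous_Re _ _ Hf); assert (Hfi := continuous_Im _ _ Hf).
  assert (Hgr := continuous_Re _ _ Hg); assert (Hgi := continuous_Im _ _ Hg).
  assert (Hd : @continuous C_UniformSpace R_UniformSpace
    (fun w => Re (g w) ^ 2 + Im (g w) ^ 2) z).
  { simpl; apply continuous_R_plus; repeat apply continuous_R_mult;
      try assumption; apply continuous_const. }
  apply continuous_C_of_Re_Im.
  - eapply continuous_ext; [intros w; symmetry; apply Re_Cdiv|].
    apply continuous_R_div; [|exact Hd|apply Rgt_not_eq, Hpos].
    apply continuous_R_plus; apply continuous_R_mult; assumption.
  - eapply continuous_ext; [intros w; symmetry; apply Im_Cdiv|].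
    apply continuous_R_div; [|exact Hd|apply Rgt_not_eq, Hpos].
    apply continuous_R_minus; apply continuous_R_mult; assumption.
Qed.

(** * Quotient values as punctured limits *)

Lemma locally'_C_proper (z : C) : ProperFilter' (locally' (T := C_UniformSpace) z).
Proof.
  constructor; [|apply locally'_filter].
  intros [d Hd].
  assert (Hdp := cond_pos d).
  apply (Hd (Re z + d / 2, Im z)).
  - split; simpl.
    + change (Rabs ((Re z + d / 2) - Re z) < d).
      replace (Re z + d / 2 - Re z) with (d / 2) by ring.
      rewrite Rabs_pos_eq; lra.
    + apply ball_center.
  - intros E; apply (f_equal fst) in E; unfold Re in E; simpl in E; lra.
Qed.

Lemma quotient_value_unique (F G : C -> C) (z w1 w2 : C) :
  quotient_value F G z w1 -> quotient_value F G z w2 -> w1 = w2.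
Proof.
  exact (@filterlim_locally_unique _ C_AbsRing C_NormedModule _ (locally'_C_proper z) _ w1 w2).
Qed.

Lemma quotient_value_continuous (F G : C -> C) (z : C) :
  @continuous C_UniformSpace C_UniformSpace F z ->
  @continuous C_UniformSpace C_UniformSpace G z -> G z <> RtoC 0 ->
  quotient_value F G z (F z / G z)%C.
Proof.
  intros HF HG Hz.
  intros S HS; generalize (continuous_Cdiv F G z HF HG Hz S HS).
  unfold filtermap, locally', within.
  apply filter_imp; intros v Hv _; exact Hv.
Qed.

Lemma euler_continuous (f g : C -> C) (z : C) :
  euler f g -> in_E z -> @continuous C_UniformSpace C_UniformSpace f z.
Proof. intros [f' [Hf _]]; apply (diff_E_continuous f f' z Hf). Qed.

(** The factor [1 - delta] folds both directions of the inequality into one sign condition, so a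
    single boundary argument covers [beta < 1] and [beta > 1]. *)
Lemma sim_iff (X delta : R) :
  0 <= delta -> sim X delta <-> 0 < (1 - delta) * (X - delta).
Proof.
  intros H0; unfold sim; split.
  - intros [[H1 H2]|[H1 H2]].
    + apply Rmult_lt_0_compat; lra.
    + replace ((1 - delta) * (X - delta)) with ((delta - 1) * (delta - X)) by ring.
      apply Rmult_lt_0_compat; lra.
  - intros H.
    destruct (Rtotal_order delta 1) as [Hd|[Hd|Hd]].
    + left; split; [lra|]; nra.
    + rewrite Hd in H; lra.
    + right; split; [lra|]; nra.
Qed.

(* Since [x / 0 = 0] and [Re w > 0] at the limit [w], [h] has no zero near [z] other than
   possibly [z] itself, which would be approached along a radius on which [|h|] increases. *)
Lemma starlike_nonvanishing (h k : C -> C) (gamma : R) (z : C) :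
  euler h k -> 0 <= gamma < 1 -> Re_quotient_sim k h gamma ->
  in_E z -> z <> RtoC 0 -> h z <> RtoC 0.
Proof.
  intros Hhk Hg HB Hz Hz0; unfold in_E in Hz.
  destruct (HB z Hz) as [w [Hw Hs]].
  assert (Hw0 : 0 < Re w) by (destruct Hs; lra).
  assert (Hnear : locally' (T := C_UniformSpace) z (fun u => 0 < Re (k u / h u)%C)).
  { apply (Hw (fun v => 0 < Re v)).
    apply (continuous_Re (fun v => v) w (continuous_id w) (fun x => 0 < x)).
    exact (open_gt 0 _ Hw0). }
  apply locally_C_box in Hnear; destruct Hnear as [d Hd].
  assert (Hdp := cond_pos d).
  (* The coordinates of [z] are at most 1 in modulus, so [t >= 1 - d / 2] keeps [t z] within the box
     of size [d]; the bound [1 / 2] keeps [a] positive. *)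
  pose (a := Rmax (1 / 2) (1 - d / 2)).
  assert (Ha1 : 1 / 2 <= a) by apply Rmax_l.
  assert (Ha2 : 1 - d / 2 <= a) by apply Rmax_r.
  assert (Ha3 : a < 1) by (apply Rmax_lub_lt; lra).
  assert (M1 := Rle_trans _ _ _ (Rmax_l _ _) (Rmax_Cmod z)).
  assert (M2 := Rle_trans _ _ _ (Rmax_r _ _) (Rmax_Cmod z)).
  apply (radial_nonvanishing h k z a Hhk Hz); [lra|].
  intros t Ht.
  assert (Hpos : 0 < Re (k (RtoC t * z) / h (RtoC t * z))%C).
  { apply Hd.
    - replace (Re (RtoC t * z)%C - Re z) with (- (1 - t) * fst z) by (unfold Re; simpl; ring).
      rewrite Rabs_mult, Rabs_Ropp, (Rabs_pos_eq (1 - t)) by lra; nra.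
    - replace (Im (RtoC t * z)%C - Im z) with (- (1 - t) * snd z) by (unfold Im; simpl; ring).
      rewrite Rabs_mult, Rabs_Ropp, (Rabs_pos_eq (1 - t)) by lra; nra.
    - intros E.
      assert (E' : (RtoC (1 - t) * z)%C = RtoC 0).
      { rewrite RtoC_minus.
        replace ((1 - RtoC t) * z)%C with (z - RtoC t * z)%C by ring.
        rewrite E; ring. }
      revert E'; apply Cmult_neq_0; [|exact Hz0].
      intros E'; apply RtoC_inj in E'; lra. }
  set (v := (RtoC t * z)%C) in *.
  assert (Hv : h v <> RtoC 0).
  { intros E; rewrite Re_Cdiv, E in Hpos; simpl in Hpos.
    rewrite !Rmult_0_r, Rplus_0_r in Hpos; unfold Rdiv in Hpos.
    rewrite Rmult_0_l in Hpos; lra. }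
  split; [exact Hv|].
  assert (Hh2 := Re_Im_sqr_pos _ Hv).
  rewrite Re_Cdiv in Hpos.
  replace (Re (k v * Cconj (h v))%C) with (Re (k v) * Re (h v) + Im (k v) * Im (h v))
    by (unfold Cconj, Re, Im; simpl; ring).
  apply (Rmult_lt_compat_r _ _ _ Hh2) in Hpos.
  unfold Rdiv in Hpos; rewrite Rmult_assoc, Rinv_l in Hpos by lra; lra.
Qed.

Lemma Re_quotient_sim_value (F G : C -> C) (delta : R) (z : C) :
  Re_quotient_sim F G delta -> in_E z ->
  @continuous C_UniformSpace C_UniformSpace F z ->
  @continuous C_UniformSpace C_UniformSpace G z -> G z <> RtoC 0 ->
  sim (Re (F z / G z)%C) delta.
Proof.
  intros H Hz HF HG Hne; destruct (H z Hz) as [w [Hw Hs]].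
  rewrite (quotient_value_unique _ _ _ _ _ (quotient_value_continuous F G z HF HG Hne) Hw).
  exact Hs.
Qed.

(** * The boundary argument for quotients *)

Lemma euler_inward_derive (f g : C -> C) (z0 c : C) :
  euler f g -> in_E z0 ->
  is_derive (fun t : R => Re (f (z0 + RtoC t * - (c * z0))%C)) 0 (Re (- (c * g z0))%C) /\
  is_derive (fun t : R => Im (f (z0 + RtoC t * - (c * z0))%C)) 0 (Im (- (c * g z0))%C).
Proof.
  intros [f' [Hf Hg]] Hz.
  assert (E : (z0 + RtoC 0 * - (c * z0))%C = z0) by ring.
  destruct (diff_E_derive f f' z0 (- (c * z0))%C 0 Hf) as [D1 D2]; [rewrite E; exact Hz|].
  rewrite E in D1, D2.
  replace (- (c * z0) * f' z0)%C with (- (c * g z0))%C in D1, D2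
    by (rewrite Hg by exact Hz; ring).
  split; assumption.
Qed.

(* With [q = F1 / G0] and [c = G0 / (G1 + G0)], the derivative of [q] at [z0] in the
   direction [- c z0] is [q - (F2 + F1) / (G1 + G0)]; as [Re c > 0], this direction points
   into the disk [|z| < |z0|]. *)
Lemma boundary_quotient_le (s beta : R) (F0 F1 F2 G0 G1 : C -> C) (z0 : C) :
  euler F0 F1 -> euler F1 F2 -> euler G0 G1 -> in_E z0 -> z0 <> RtoC 0 ->
  G0 z0 <> RtoC 0 -> 0 <= Re (G1 z0 / G0 z0)%C ->
  s * (Re (F1 z0 / G0 z0)%C - beta) = 0 ->
  (forall z, z <> RtoC 0 -> Cmod z < Cmod z0 -> 0 < s * (Re (F1 z / G0 z)%C - beta)) ->
  s * (Re ((F2 z0 + F1 z0) / (G1 z0 + G0 z0))%C - beta) <= 0.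
Proof.
  intros HF0 HF1 HG0 Hz Hz0 HG Hp Hq Hin.
  set (p := (G1 z0 / G0 z0)%C) in *.
  assert (HG1 : G1 z0 = (p * G0 z0)%C) by (unfold p; field; exact HG).
  assert (Hp1 : (p + 1)%C <> RtoC 0).
  { intros E; apply (f_equal Re) in E; rewrite re_plus, !re_RtoC in E; lra. }
  assert (Hsum : (G1 z0 + G0 z0)%C <> RtoC 0).
  { rewrite HG1; replace (p * G0 z0 + G0 z0)%C with ((p + 1) * G0 z0)%C by ring.
    apply Cmult_neq_0; assumption. }
  set (c := (1 / (p + 1))%C).
  assert (Hc : 0 < Re c).
  { unfold c; rewrite Re_Cdiv.
    apply Rdiv_lt_0_compat; [|apply Re_Im_sqr_pos, Hp1].
    rewrite re_plus, !re_RtoC, im_RtoC; lra. }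
  destruct (euler_inward_derive F1 F2 z0 c HF1 Hz) as [A1 A2].
  destruct (euler_inward_derive G0 G1 z0 c HG0 Hz) as [B1 B2].
  assert (E : (z0 + RtoC 0 * - (c * z0))%C = z0) by ring.
  assert (D := is_derive_Re_Cdiv (fun t : R => F1 (z0 + RtoC t * - (c * z0))%C)
    (fun t : R => G0 (z0 + RtoC t * - (c * z0))%C) 0 _ _
    ltac:(cbv beta; rewrite E; exact HG) A1 A2 B1 B2).
  cbv beta in D; rewrite E in D.
  replace ((- (c * F2 z0) * G0 z0 - F1 z0 * - (c * G1 z0)) / (G0 z0 * G0 z0))%C
    with (F1 z0 / G0 z0 - (F2 z0 + F1 z0) / (G1 z0 + G0 z0))%C in D.
  2:{ rewrite HG1 in Hsum |- *; unfold c; field; repeat split; assumption. }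
  assert (Hn := inward_derivative_nonneg (fun z => s * (Re (F1 z / G0 z)%C - beta)) z0 c
    (s * (Re (F1 z0 / G0 z0)%C - Re ((F2 z0 + F1 z0) / (G1 z0 + G0 z0))%C - 0)) Hz0 Hc Hq Hin).
  (* As [s (Re q - beta) = 0] at [z0], nonnegativity of this derivative amounts to the claim. *)
  enough (0 <= s * (Re (F1 z0 / G0 z0)%C - Re ((F2 z0 + F1 z0) / (G1 z0 + G0 z0))%C - 0)) by lra.
  apply Hn.
  apply is_derive_scal.
  apply @is_derive_minus; [|apply @is_derive_const].
  unfold Cminus in D; rewrite re_plus, re_opp in D; exact D.
Qed.

(** [P] is [F z / z] with the singularity at 0 removed, and the value 1 there expresses the
    normalization of [F]. Quotients of two such [F] extend continuously through the origin as
    quotients of the [P]. *)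
Definition normalized_factor (F P : C -> C) : Prop :=
  P (RtoC 0) = RtoC 1 /\
  (forall z, in_E z -> @continuous C_UniformSpace C_UniformSpace P z) /\
  (forall z, in_E z -> F z = (z * P z)%C).

(** For [q = 0] both sides are 0 by the convention for division, so the cancellation is available
    before zeros of the denominator are excluded. *)
Lemma Cdiv_cancel_factor (z p q : C) : z <> RtoC 0 -> (z * p / (z * q))%C = (p / q)%C.
Proof.
  intros Hz; destruct (classic (q = RtoC 0)) as [->|Hq].
  - rewrite Cmult_0_r; unfold Cdiv.
    replace (/ RtoC 0)%C with (RtoC 0); [ring|].
    unfold Cinv; simpl; unfold RtoC; f_equal; unfold Rdiv; rewrite ?Ropp_0; ring.
  - field; split; assumption.
Qed.

(** With [Q] free of zeros, [P / Q] is continuous on the disk, and [(1 - beta) (Re (P / Q) - beta)]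
    starts at [(1 - beta)^2 > 0] at the origin. At a first zero [boundary_quotient_le] contradicts
    the strict inequality assumed for [(F2 + F1) / (G1 + G0)]. *)
Lemma quotient_sim_libera (beta : R) (F0 F1 F2 G0 G1 P Q : C -> C) :
  0 <= beta -> beta <> 1 ->
  euler F0 F1 -> euler F1 F2 -> euler G0 G1 ->
  normalized_factor F1 P -> normalized_factor G0 Q ->
  (forall z, in_E z -> Q z <> RtoC 0) ->
  (forall z, in_E z -> z <> RtoC 0 -> 0 <= Re (G1 z / G0 z)%C) ->
  (forall z, in_E z -> z <> RtoC 0 ->
     sim (Re ((F2 z + F1 z) / (G1 z + G0 z))%C) beta) ->
  Re_quotient_sim F1 G0 beta.
Proof.
  intros Hb0 Hb1 HF0 HF1 HG0 [HP0 [HPc HP]] [HQ0 [HQc HQ]] HQne Hp Hsim z Hz.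
  assert (Hquot : forall z, z <> RtoC 0 -> in_E z -> (F1 z / G0 z = P z / Q z)%C).
  { intros v Hv0 Hv; rewrite HP, HQ by exact Hv; apply Cdiv_cancel_factor, Hv0. }
  exists (P z / Q z)%C; split.
  (* The limit is computed on [P / Q], which agrees with the quotient off the origin and is
     continuous at [z], including [z = 0]. *)
  - apply (filterlim_ext_loc (fun v => P v / Q v)%C).
    2:{ apply (quotient_value_continuous P Q z); auto. }
    assert (Hopen : locally (T := C_UniformSpace) z in_E).
    { apply (@locally_le_locally_norm C_AbsRing C_NormedModule).
      unfold in_E in Hz.
      exists (mkposreal (1 - Cmod z) ltac:(lra)); intros v Hv.
      change (Cmod (v - z)%C < 1 - Cmod z) in Hv.
      assert (H := Cmod_le_minus_plus v z); unfold in_E; lra. }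
    unfold locally', within.
    destruct (classic (z = RtoC 0)) as [Hz0|Hz0].
    + rewrite Hz0 in Hopen |- *.
      revert Hopen; apply filter_imp; intros v Hv Hv0; symmetry; apply Hquot; assumption.
    + assert (Hne : locally (T := C_UniformSpace) z (fun v => v <> RtoC 0)).
      { apply (@locally_le_locally_norm C_AbsRing C_NormedModule).
        assert (Hm : 0 < Cmod z) by (apply Cmod_gt_0, Hz0).
        exists (mkposreal _ Hm); intros v Hv E.
        change (Cmod (v - z)%C < Cmod z) in Hv.
        rewrite E in Hv; replace (0 - z)%C with (- z)%C in Hv by ring.
        rewrite Cmod_opp in Hv; lra. }
      generalize (filter_and _ _ Hopen Hne); apply filter_imp.
      intros v [Hv Hv0] _; symmetry; apply Hquot; assumption.
  - apply sim_iff; [exact Hb0|].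
    apply Rnot_le_lt; intros Hneg.
    destruct (first_nonpositive (fun v => (1 - beta) * (Re (P v / Q v)%C - beta)) z)
      as [z0 [Hz0 [Hz0n [Hu0 Hu]]]].
    + intros v Hv; apply continuous_R_mult; [apply continuous_const|].
      apply continuous_R_minus; [|apply continuous_const].
      apply continuous_Re, continuous_Cdiv; auto.
    + rewrite HP0, HQ0; replace (1 / 1)%C with (RtoC 1) by field.
      rewrite re_RtoC; nra.
    + exact Hz.
    + exact Hneg.
    + assert (HG : G0 z0 <> RtoC 0).
      { rewrite HQ by exact Hz0; apply Cmult_neq_0; auto. }
      assert (Hle := boundary_quotient_le (1 - beta) beta F0 F1 F2 G0 G1 z0
        HF0 HF1 HG0 Hz0 Hz0n HG (Hp z0 Hz0 Hz0n)).
      assert (Hs := Hsim z0 Hz0 Hz0n).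
      apply sim_iff in Hs; [|exact Hb0].
      apply Rlt_not_le in Hs; apply Hs, Hle.
      * rewrite Hquot by assumption; exact Hu0.
      * intros v Hv0 Hv.
        rewrite Hquot; [apply Hu, Hv|exact Hv0|unfold in_E in *; lra].
Qed.

(* The order of starlikeness is inherited by the Libera transform [G0] of
   [(G1 + G0) / 2]. The real part of [(P - gamma Q) conj Q] is positive exactly where [Q]
   is nonzero and [Re (G1 / G0) > gamma], and it is continuous without assuming [Q] nonzero. *)
Lemma starlike_libera (gamma : R) (G0 G1 G2 P Q : C -> C) :
  0 <= gamma < 1 -> euler G0 G1 -> euler G1 G2 ->
  normalized_factor G1 P -> normalized_factor G0 Q ->
  (forall z, in_E z -> z <> RtoC 0 -> gamma < Re ((G2 z + G1 z) / (G1 z + G0 z))%C) ->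
  forall z, in_E z -> Q z <> RtoC 0 /\ gamma < Re (P z / Q z)%C.
Proof.
  intros Hg HG0 HG1 [HP0 [HPc HP]] [HQ0 [HQc HQ]] Hs.
  pose (u := fun v => (Re (P v) - gamma * Re (Q v)) * Re (Q v)
                    + (Im (P v) - gamma * Im (Q v)) * Im (Q v)).
  assert (Hu_pos : forall v, 0 < u v -> Q v <> RtoC 0 /\ gamma < Re (P v / Q v)%C).
  { intros v Hv.
    assert (HQv : Q v <> RtoC 0).
    { intros E; unfold u in Hv; rewrite E in Hv; simpl in Hv; lra. }
    split; [exact HQv|].
    assert (Hq := Re_Im_sqr_pos _ HQv).
    rewrite Re_Cdiv; apply Rlt_div_r; [lra|].
    unfold u in Hv; simpl in *; lra. }
  assert (Hu_zero : forall v, u v = 0 -> Q v <> RtoC 0 -> Re (P v / Q v)%C = gamma).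
  { intros v Hv HQv.
    assert (Hq := Re_Im_sqr_pos _ HQv).
    rewrite Re_Cdiv; apply (Rmult_eq_reg_r (Re (Q v) ^ 2 + Im (Q v) ^ 2)); [|lra].
    unfold Rdiv; rewrite Rmult_assoc, Rinv_l by lra.
    unfold u in Hv; simpl in *; lra. }
  intros z Hz; apply Hu_pos, Rnot_le_lt; intros Hneg.
  destruct (first_nonpositive u z) as [z0 [Hz0 [Hz0n [Hu0 Hu]]]]; [| |exact Hz|exact Hneg|].
  { intros v Hv; unfold u.
    assert (C1 := continuous_Re _ _ (HPc v Hv)); assert (C2 := continuous_Im _ _ (HPc v Hv)).
    assert (C3 := continuous_Re _ _ (HQc v Hv)); assert (C4 := continuous_Im _ _ (HQc v Hv)).
    repeat first [assumption | apply continuous_R_minus | apply continuous_R_plus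
      | apply continuous_R_mult | apply continuous_const]. }
  { unfold u; rewrite HP0, HQ0; simpl; lra. }
  assert (Hquot : forall v, v <> RtoC 0 -> in_E v -> (G1 v / G0 v = P v / Q v)%C).
  { intros v Hv0 Hv; rewrite HP, HQ by exact Hv; apply Cdiv_cancel_factor, Hv0. }
  (* A zero of [Q] would also make [u] vanish, so it must be excluded before [u z0 = 0] can be read
     as [Re (P / Q) = gamma]. Since [u > 0] at every point of smaller modulus, any starting point of
     the radius in [(0, 1)] would do. *)
  assert (HG0z : G0 z0 <> RtoC 0).
  { apply (radial_nonvanishing G0 G1 z0 (1 / 2) HG0 Hz0); [lra|].
    intros t Ht; unfold in_E in Hz0.
    assert (Hz0p : 0 < Cmod z0) by (apply Cmod_gt_0, Hz0n).
    assert (Hm : Cmod (RtoC t * z0)%C = t * Cmod z0)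
      by (rewrite Cmod_mult, Cmod_R, Rabs_pos_eq; lra).
    assert (Hv0 : (RtoC t * z0)%C <> RtoC 0) by (apply Cmod_gt_0; rewrite Hm; nra).
    assert (HvE : in_E (RtoC t * z0)%C) by (unfold in_E; rewrite Hm; nra).
    assert (Hv := Hu (RtoC t * z0)%C ltac:(rewrite Hm; nra)).
    set (v := (RtoC t * z0)%C) in *.
    destruct (Hu_pos v Hv) as [HQv HPQ].
    rewrite <- Hquot in HPQ by assumption.
    assert (HG0v : G0 v <> RtoC 0) by (rewrite HQ by exact HvE; apply Cmult_neq_0; assumption).
    split; [exact HG0v|].
    assert (Hq := Re_Im_sqr_pos _ HG0v).
    rewrite Re_Cdiv in HPQ; apply Rlt_div_r in HPQ; [|exact Hq].
    assert (0 <= gamma * (Re (G0 v) ^ 2 + Im (G0 v) ^ 2)) by (apply Rmult_le_pos; lra).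
    replace (Re (G1 v * Cconj (G0 v))%C) with (Re (G1 v) * Re (G0 v) + Im (G1 v) * Im (G0 v))
      by (unfold Cconj, Re, Im; simpl; ring).
    lra. }
  assert (HQz : Q z0 <> RtoC 0).
  { intros E; apply HG0z; rewrite HQ by exact Hz0; rewrite E; ring. }
  assert (Hpz : Re (G1 z0 / G0 z0)%C = gamma).
  { rewrite Hquot by assumption; apply Hu_zero; assumption. }
  (* The case where [F] and [G] coincide, with sign [s = 1]; here [Re p = gamma >= 0] at [z0]. *)
  assert (Hle := boundary_quotient_le 1 gamma G0 G1 G2 G0 G1 z0 HG0 HG1 HG0 Hz0 Hz0n HG0z
    ltac:(rewrite Hpz; lra) ltac:(rewrite Hpz; ring)).
  specialize (Hs z0 Hz0 Hz0n).
  apply (Rlt_irrefl gamma).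
  eapply Rlt_le_trans; [exact Hs|].
  enough (1 * (Re ((G2 z0 + G1 z0) / (G1 z0 + G0 z0))%C - gamma) <= 0) by lra.
  apply Hle; intros v Hv0 Hv.
  rewrite Hquot; [|exact Hv0|unfold in_E in *; lra].
  destruct (Hu_pos v (Hu v Hv)) as [_ H]; lra.
Qed.

(** * Power series for [L] and the inclusion of classes *)

Lemma CPSeries_z_mul (a b : nat -> C) (z : C) :
  subgeometric b -> in_E z -> a 0%nat = RtoC 0 -> (forall k, a (S k) = b k) ->
  CPSeries a z = (z * CPSeries b z)%C.
Proof.
  intros Hb Hz Ha0 Hab.
  apply CPSeries_unique, is_pseries_Cpow.
  apply (is_series_decr_1 (K := C_AbsRing) (V := C_NormedModule)).
  replace (plus (z * CPSeries b z)%C (opp _)) with ((z * CPSeries b z)%C : C_NormedModule).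
  - generalize (is_series_scal_l (K := C_AbsRing) (V := C_NormedModule) z _ _
      (subgeometric_CPSeries b z Hb Hz)).
    apply is_series_ext; intros k; rewrite Hab, Cpow_S.
    change ((z * (b k * z ^ k))%C = (b k * (z * z ^ k))%C); ring.
  - change ((z * CPSeries b z)%C = (z * CPSeries b z + - (a 0%nat * z ^ 0))%C).
    rewrite Ha0; ring.
Qed.

Lemma euler_CPSeries (a b : nat -> C) :
  subgeometric a -> (forall k, b k = (RtoC (INR k) * a k)%C) ->
  euler (CPSeries a) (CPSeries b).
Proof.
  intros Ha Hb; exists (CPSeries (coef_deriv a)); split.
  - intros r Hr; apply CPSeries_taylor; assumption.
  - intros z Hz; apply CPSeries_z_mul.
    + apply subgeometric_deriv, Ha.
    + exact Hz.
    + rewrite Hb; simpl; ring.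
    + intros k; rewrite Hb; reflexivity.
Qed.

Lemma normalized_factor_CPSeries (a : nat -> C) :
  subgeometric a -> a 0%nat = RtoC 0 -> a 1%nat = RtoC 1 ->
  normalized_factor (CPSeries a) (CPSeries (fun k => a (S k))).
Proof.
  intros Ha Ha0 Ha1.
  assert (Hb := subgeometric_shift a Ha).
  split; [|split].
  - apply CPSeries_unique, is_pseries_Cpow.
    apply (is_series_decr_1 (K := C_AbsRing) (V := C_NormedModule)).
    replace (plus (RtoC 1) (opp _)) with (zero : C_NormedModule).
    + apply (is_series_ext (K := C_AbsRing) (V := C_NormedModule) (fun _ => zero)).
      { intros k; rewrite Cpow_S; change (RtoC 0 = (a (S (S k)) * (0 * 0 ^ k))%C); ring. }
      unfold is_series.
      apply (filterlim_ext (fun _ => zero)); [|apply filterlim_const].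
      intros n; symmetry; exact (sum_n_m_const_zero (G := C_NormedModule) 0 n).
    + change (RtoC 0 = (RtoC 1 + - (a 1%nat * 0 ^ 0))%C); rewrite Ha1; simpl; ring.
  - intros z Hz; apply (diff_E_continuous _ (CPSeries (coef_deriv (fun k => a (S k))))).
    + intros r Hr; apply CPSeries_taylor; assumption.
    + exact Hz.
  - intros z Hz; apply CPSeries_z_mul; auto.
Qed.

Lemma coef_correct (f : C -> C) : class_A f -> normalized_expansion f (coef f).
Proof. intros H; exact (epsilon_spec _ _ H). Qed.

Lemma subgeometric_coef (f : C -> C) : class_A f -> subgeometric (coef f).
Proof.
  intros H; exact (normalized_expansion_subgeometric _ _ (coef_correct f H)).
Qed.

Lemma L_euler (n : nat) (sigma : R) (f : C -> C) :
  class_A f -> euler (L n sigma f) (L (S n) sigma f).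
Proof.
  intros Hf; apply euler_CPSeries.
  - apply subgeometric_multiplier, subgeometric_coef, Hf.
  - intros k; rewrite Cmult_assoc, <- RtoC_mult; f_equal; f_equal; simpl; ring.
Qed.

Lemma L_normalized_factor (n : nat) (sigma : R) (f : C -> C) :
  class_A f -> exists P, normalized_factor (L n sigma f) P.
Proof.
  intros Hf; eexists; apply normalized_factor_CPSeries.
  - apply subgeometric_multiplier, subgeometric_coef, Hf.
  - destruct (coef_correct f Hf) as [-> _]; ring.
  - destruct (coef_correct f Hf) as [_ [-> _]].
    simpl INR; rewrite pow1, Rmult_1_l, Cmult_1_r; f_equal.
    replace (2 / (1 + 1)) with 1 by field.
    unfold Rpower; rewrite ln_1, Rmult_0_r; apply exp_0.
Qed.

(** Raising [sigma] by one multiplies the coefficient of [z^k] by [2 / (k + 1)], which is the Libera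
    transform; applying [(D + 1) / 2] multiplies it by [(k + 1) / 2] and undoes this. *)
Lemma L_libera (n : nat) (sigma : R) (f : C -> C) (z : C) :
  class_A f -> in_E z ->
  L n sigma f z = (/ 2 * (L (S n) (sigma + 1) f z + L n (sigma + 1) f z))%C.
Proof.
  intros Hf Hz.
  assert (Ha := subgeometric_coef f Hf).
  apply CPSeries_unique, is_pseries_Cpow.
  generalize (is_series_scal_l (K := C_AbsRing) (V := C_NormedModule) (/ 2)%C _ _
    (is_series_plus _ _ _ _
      (subgeometric_CPSeries _ z (subgeometric_multiplier (S n) (sigma + 1) _ Ha) Hz)
      (subgeometric_CPSeries _ z (subgeometric_multiplier n (sigma + 1) _ Ha) Hz))).
  apply is_series_ext; intros k.
  assert (Hk := pos_INR k).
  rewrite Rpower_plus, Rpower_1 by (apply Rdiv_lt_0_compat; lra).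
  set (m := Rpower (2 / (INR k + 1)) sigma).
  change ((/ 2 * (RtoC (INR k ^ S n * (m * (2 / (INR k + 1)))) * coef f k * z ^ k
    + RtoC (INR k ^ n * (m * (2 / (INR k + 1)))) * coef f k * z ^ k))%C
    = (RtoC (INR k ^ n * m) * coef f k * z ^ k)%C).
  replace (INR k ^ n * m)
    with (/ 2 * (INR k ^ S n * (m * (2 / (INR k + 1))) + INR k ^ n * (m * (2 / (INR k + 1)))))
    by (simpl; field; lra).
  rewrite (RtoC_mult (/ 2)), RtoC_plus, RtoC_inv by lra; ring.
Qed.

Theorem theorem2 (n : nat) (sigma beta gamma : R)
  (hbeta0 : 0 <= beta) (hbeta1 : beta <> 1) (hgamma : 0 <= gamma < 1) :
  forall f : C -> C,
    class_K n sigma beta gamma f -> class_K n (sigma + 1) beta gamma f.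
Proof.
  intros f [Hf [g [[Hg HB] HK]]].
  assert (Hhalf : (/ 2)%C <> RtoC 0).
  { rewrite <- RtoC_inv by lra; intros E; apply RtoC_inj in E; lra. }
  assert (Hne : forall z, in_E z -> z <> RtoC 0 -> L n sigma g z <> RtoC 0).
  { intros z; apply (starlike_nonvanishing _ (L (S n) sigma g) gamma); auto.
    apply L_euler, Hg. }
  (* Off the origin the denominator is nonzero, so the limit in the hypothesis is a pointwise
     quotient. Rewriting both terms at exponent [sigma + 1] produces a common factor [/ 2], which
     cancels. *)
  assert (Hval : forall (h : C -> C) (delta : R), class_A h ->
    Re_quotient_sim (L (S n) sigma h) (L n sigma g) delta ->
    forall z, in_E z -> z <> RtoC 0 ->
    sim (Re ((L (S (S n)) (sigma + 1) h z + L (S n) (sigma + 1) h z)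
           / (L (S n) (sigma + 1) g z + L n (sigma + 1) g z))%C) delta).
  { intros h delta Hh Hq z Hz Hz0.
    rewrite <- (Cdiv_cancel_factor (/ 2)%C), <- !L_libera by assumption.
    apply Re_quotient_sim_value; auto.
    - apply (euler_continuous _ (L (S (S n)) sigma h)); [apply L_euler, Hh|exact Hz].
    - apply (euler_continuous _ (L (S n) sigma g)); [apply L_euler, Hg|exact Hz]. }
  destruct (L_normalized_factor n (sigma + 1) g Hg) as [Q HQ].
  destruct (L_normalized_factor (S n) (sigma + 1) g Hg) as [Pg HPg].
  destruct (L_normalized_factor (S n) (sigma + 1) f Hf) as [Pf HPf].
  assert (Hstar := starlike_libera gamma _ _ _ Pg Q hgamma
    (L_euler n (sigma + 1) g Hg) (L_euler (S n) (sigma + 1) g Hg) HPg HQ).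
  assert (HS : forall z, in_E z -> Q z <> RtoC 0 /\ gamma < Re (Pg z / Q z)%C).
  { apply Hstar; intros z Hz Hz0.
    destruct (Hval g gamma Hg HB z Hz Hz0); lra. }
  assert (Hp : forall z, in_E z -> z <> RtoC 0 ->
    0 <= Re (L (S n) (sigma + 1) g z / L n (sigma + 1) g z)%C).
  { intros z Hz Hz0.
    destruct HPg as [_ [_ HPg]], HQ as [_ [_ HQ]].
    rewrite HPg, HQ, Cdiv_cancel_factor by assumption.
    destruct (HS z Hz); lra. }
  (* Used for [f] with [beta] and for [g] with [gamma]: the second instance shows that [g] is again
     an admissible witness at exponent [sigma + 1]. *)
  assert (Hconcl : forall (h : C -> C) (delta : R), 0 <= delta -> delta <> 1 -> class_A h ->
    Re_quotient_sim (L (S n) sigma h) (L n sigma g) delta ->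
    Re_quotient_sim (L (S n) (sigma + 1) h) (L n (sigma + 1) g) delta).
  { intros h delta Hd0 Hd1 Hh Hq.
    destruct (L_normalized_factor (S n) (sigma + 1) h Hh) as [P HP].
    apply (quotient_sim_libera delta (L n (sigma + 1) h) _
      (L (S (S n)) (sigma + 1) h) _ (L (S n) (sigma + 1) g) P Q); auto using L_euler.
    intros z Hz; apply HS, Hz. }
  split; [exact Hf|]; exists g; split; [split; [exact Hg|]|]; apply Hconcl; auto; lra.
Qed.
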